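(* Let $P=(X,\prec)$ be a poset on $|X|\ge 2$ elements and fix a nonempty subset $A\subseteq X$. Let $f$ be a uniformly random linear extension of $P$ and let $f_{\min}(A):=\min\{f(a):a\in A\}$. Then $$\mathbb{P}[f_{\min}(A)>1]^2\ \ge\ \mathbb{P}[f_{\min}(A)>2]$$ and $$\mathbb{P}[f_{\min}(A)=1]\cdot\mathbb{P}[f_{\min}(A)>1]\ \le\ \mathbb{P}[f_{\min}(A)=2].$$
   Context: A linear extension of a poset $P=(X,\prec)$ with $|X|=n$ is a bijection $f:X\to\{1,\dots,n\}$ such that $u\prec v$ implies $f(u)<f(v)$. Probabilities are with respect to the uniform distribution on the set of linear extensions of $P$. *)

(* Defs.v *)
From mathcomp Require Import all_boot all_order all_algebra.

Set Implicit Arguments.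
Unset Strict Implicit.
Unset Printing Implicit Defensive.

Import Order.TTheory GRing.Theory Num.Theory.

Section LinearExtensions.

Variables (d : Order.disp_t) (X : finPOrderType d).

(* {1, ..., n} is encoded as 'I_n through i |-> i.+1. *)
Definition bijectiveb (f : {ffun X -> 'I_#|X|}) : bool :=
  injectiveb f && [forall i, exists x, f x == i].

Definition lin_ext : {set {ffun X -> 'I_#|X|}} :=
  [set f | bijectiveb f &&
           [forall u, forall v, (u < v)%O ==> (f u < f v)%N]].

Definition pos (f : {ffun X -> 'I_#|X|}) (x : X) : nat := (f x).+1.

(* The default value #|X| is an upper bound of pos f, so for A nonempty this
   is the minimum of pos f over A. *)
Definition fmin (A : {set X}) (f : {ffun X -> 'I_#|X|}) : nat :=
  \big[minn/#|X|]_(a in A) pos f a.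

Definition Pr (E : pred {ffun X -> 'I_#|X|}) : rat :=
  (#|[set f in lin_ext | E f]|%:R / #|lin_ext|%:R)%R.

End LinearExtensions.

(* Main.v *)
Require Import Defs.
From mathcomp Require Import all_boot all_order all_algebra.
From mathcomp Require Import ring lra.

Set Implicit Arguments.
Unset Strict Implicit.
Unset Printing Implicit Defensive.

Import Order.TTheory GRing.Theory Num.Theory.

(* Both inequalities say N_2 N_0 <= N_1^2, where N_k is the number of linear
   extensions with f_min(A) > k.  Counting linear extensions by their first two
   elements x, y defines a symmetric form M on functions on the minimal
   elements: a pair with y minimal contributes to the entry (x, y), a pair with
   y not minimal (x is then its only predecessor) to the entry (x, x).  With v the indicator
   of the complement of A, N_0 = M(1,1), N_1 = M(v,1) and N_2 <= M(v,v), so it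
   suffices that M(v,v) M(1,1) <= M(v,1)^2 for all v.

   This is proved by induction on the poset, in the style of the combinatorial
   atlases of Chan and Pak.  Removing a minimal element x transports v to a
   function v_x on the minimal elements of P - x, with (M v)_x = M_x(v_x, 1) and
   (M 1)_x = M_x(1, 1).  The induction hypothesis gives
     sum_x (M v)_x^2 / (M 1)_x >= sum_x M_x(v_x, v_x) >= M(v, v),
   where the last step is a check over the possible posets formed by the first
   three elements.  A spectral argument turns this into hyperbolicity of M. *)

Local Open Scope ring_scope.

(** Fredholm alternative: [u] lies in the row space of the matrix as soon as the columns of its
    cokernel kill it, and these columns are among the vectors [c] of the hypothesis. Symmetry turns
    the resulting row combination into a solution. *)
Lemma fredholm_sym (F : fieldType) (T : finType) (L : T -> T -> F) (u : T -> F) :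
    (forall x y, L x y = L y x) ->
    (forall c, (forall x, \sum_y L x y * c y = 0) -> \sum_x u x * c x = 0) ->
  exists w, forall x, \sum_y L x y * w y = u x.
Proof.
move=> Lsym uker.
have sumE (G : T -> F) : \sum_x G x = \sum_(i < #|T|) G (enum_val i).
  by rewrite -big_enum_val; apply: eq_bigl.
pose A := \matrix_(i < #|T|, j < #|T|) L (enum_val i) (enum_val j).
have AE i j : A i j = L (enum_val i) (enum_val j) by rewrite mxE.
pose U := \row_(i < #|T|) u (enum_val i).
have /submxP[W UW] : (U <= A)%MS.
  rewrite submxE; apply/eqP/matrixP => i j; rewrite !mxE.
  rewrite -[RHS](uker (fun x => cokermx A (enum_rank x) j)).
    rewrite sumE; apply: eq_bigr => k _; rewrite mxE enum_valK //.
  move=> x; have /matrixP/(_ (enum_rank x) j) := mulmx_coker A.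
  rewrite [LHS]mxE [RHS]mxE sumE => AK; rewrite -[RHS]AK; apply: eq_bigr => k _.
  by rewrite AE enum_rankK enum_valK.
exists (fun x => W 0 (enum_rank x)) => x.
have /matrixP/(_ 0 (enum_rank x)) := UW; rewrite !mxE enum_rankK => ->.
rewrite sumE; apply: eq_bigr => k _.
by rewrite AE enum_rankK enum_valK Lsym mulrC.
Qed.

(** * Symmetric nonnegative matrices and the hyperbolic inequality *)

Section Hyperbolic.

Variables (R : realFieldType) (T : finType) (N : T -> T -> R).

Definition degree x : R := \sum_y N x y.

Definition apply_form (v : T -> R) x : R := \sum_y N x y * v y.

Definition qform (v w : T -> R) : R := \sum_x v x * apply_form w x.

Hypothesis Nsym : forall x y, N x y = N y x.
Hypothesis Nge0 : forall x y, 0 <= N x y.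

Lemma qform_sym v w : qform v w = qform w v.
Proof.
rewrite /qform /apply_form; under eq_bigr do rewrite mulr_sumr.
rewrite exchange_big /=; apply: eq_bigr => x _; rewrite mulr_sumr.
by apply: eq_bigr => y _; rewrite Nsym; ring.
Qed.

Lemma qformBl u v w : qform (fun x => u x - v x) w = qform u w - qform v w.
Proof. by rewrite /qform -sumrB; apply: eq_bigr => x _; rewrite mulrBl. Qed.

Lemma qformBr u v w : qform w (fun x => u x - v x) = qform w u - qform w v.
Proof. by rewrite qform_sym qformBl !(qform_sym w). Qed.

Lemma qformZl c v w : qform (fun x => c * v x) w = c * qform v w.
Proof. by rewrite /qform mulr_sumr; apply: eq_bigr => x _; rewrite mulrA. Qed.

Lemma qformZr c v w : qform v (fun x => c * w x) = c * qform v w.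
Proof. by rewrite qform_sym qformZl qform_sym. Qed.

Lemma qform1r v : qform v (fun=> 1) = \sum_x v x * degree x.
Proof.
apply: eq_bigr => x _; congr (_ * _).
by apply: eq_bigr => y _; rewrite mulr1.
Qed.

Lemma degree_ge0 x : 0 <= degree x.
Proof. exact: sumr_ge0. Qed.

Lemma degree0 x : degree x = 0 -> forall y, N x y = 0.
Proof. by move=> /eqP; rewrite psumr_eq0 // => /allP h y; apply/eqP/h/mem_index_enum. Qed.

(** Dirichlet energy of the weighted graph [N]; the double sum meets each unordered pair twice,
    hence the factor 2. *)
Lemma dirichlet v :
  (\sum_x degree x * v x ^+ 2 - qform v v) *+ 2
    = \sum_x \sum_y N x y * (v x - v y) ^+ 2.
Proof.
have dE : \sum_x degree x * v x ^+ 2 = \sum_x \sum_y N x y * v x ^+ 2.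
  by apply: eq_bigr => x _; rewrite mulr_suml.
have dE' : \sum_x degree x * v x ^+ 2 = \sum_x \sum_y N x y * v y ^+ 2.
  rewrite dE exchange_big; apply: eq_bigr => x _.
  by apply: eq_bigr => y _; rewrite Nsym.
rewrite mulr2n addrACA {1}dE dE' /qform -!sumrN -!big_split /=.
apply: eq_bigr => x _; rewrite /apply_form mulr_sumr -!sumrN -!big_split /=.
by apply: eq_bigr => y _; ring.
Qed.

Lemma qform_le_degree v : qform v v <= \sum_x degree x * v x ^+ 2.
Proof.
rewrite -subr_ge0 -(pmulrn_lge0 _ (ltn0Sn 1)) dirichlet.
by do 2!(apply: sumr_ge0 => ? _); rewrite mulr_ge0 ?sqr_ge0.
Qed.

(* Spectrally, with K = D^-1 N where D is the diagonal of degrees, the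
   hypothesis says K <= K^2, so that K has no eigenvalue in (0, 1).  The
   eigenvalue 1 is simple by connectedness, hence K <= 0 on the
   D-orthogonal of 1.  There one can solve v = (1 - K) w and use
   l (1 - l)^2 = (l - l^2) - l^2 (1 - l). *)
Lemma hyperbolic_of_contraction :
    (forall x y, x != y -> degree x != 0 -> degree y != 0 -> 0 < N x y) ->
    (forall v, qform v v <= \sum_x apply_form v x ^+ 2 / degree x) ->
  forall v, qform v v * qform (fun=> 1) (fun=> 1) <= qform v (fun=> 1) ^+ 2.
Proof.
move=> Ngt0 contr v; set one := (fun=> 1) : T -> R.
have [->|m0] := eqVneq (qform one one) 0; first by rewrite mulr0 sqr_ge0.
(* The constant [c] makes [v'] orthogonal to [one] for the form, which reduces the claim to
   [qform v' v' <= 0]. *)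
pose c := qform v one / qform one one.
pose v' x := v x - c * one x.
have v'1 : qform v' one = 0 by rewrite qformBl qformZl divfK ?subrr.
have [w wE] : exists w, forall x,
    \sum_y ((x == y)%:R * degree x - N x y) * w y = degree x * v' x.
  apply: (@fredholm_sym R T (fun x y => (x == y)%:R * degree x - N x y)
            (fun x => degree x * v' x)).
    move=> x y; rewrite Nsym; congr (_ - _).
    by rewrite eq_sym; case: eqP => [->|_] //; rewrite !mul0r.
  move=> k kker.
  (* A kernel vector of the Laplacian has zero energy, so it is constant on the vertices of nonzero
     degree, which are pairwise joined. The right-hand side is orthogonal to such vectors. *)
  have kform : \sum_x degree x * k x ^+ 2 - qform k k = 0.
    rewrite -sumrB big1 // => x _.
    rewrite -[RHS](mulr0 (k x)) -(kker x) mulr_sumr [X in _ - X]mulr_sumr.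
    under [RHS]eq_bigr do rewrite mulrBl mulrBr.
    rewrite sumrB; congr (_ - _).
    rewrite (bigD1 x) //= big1 ?eqxx; first by (rewrite addr0 mulr1n; ring).
    by move=> y yx; rewrite eq_sym (negbTE yx) mulr0n; ring.
  have kcst x y : degree x != 0 -> degree y != 0 -> k x = k y.
    move=> dx dy; have [->//|xy] := eqVneq x y.
    have := dirichlet k; rewrite kform mul0rn => /esym/eqP.
    rewrite psumr_eq0; last first.
      by move=> ? _; apply: sumr_ge0 => ? _; rewrite mulr_ge0 ?sqr_ge0.
    move=> /allP/(_ x (mem_index_enum _)); rewrite /= psumr_eq0; last first.
      by move=> ? _; rewrite mulr_ge0 ?sqr_ge0.
    move=> /allP/(_ y (mem_index_enum _)); rewrite /= mulf_eq0 sqrf_eq0.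
    by rewrite gt_eqF ?Ngt0 //= subr_eq0 => /eqP.
  have [x dx|d0] := pickP (fun x => degree x != 0); last first.
    by rewrite big1 // => x _; move/negbFE/eqP: (d0 x) => ->; ring.
  have kv'1 : k x * qform v' one = 0 by rewrite v'1 mulr0.
  rewrite -[RHS]kv'1 qform1r mulr_sumr.
  apply: eq_bigr => y _; have [->|dy] := eqVneq (degree y) 0; first by ring.
  by rewrite (kcst y x) //; ring.
pose kw x := apply_form w x / degree x.
have v'E x : degree x != 0 -> v' x = w x - kw x.
  move=> dx; apply: (mulfI dx); rewrite -wE /kw.
  under eq_bigr do rewrite mulrBl; rewrite sumrB mulrBr mulrCA divff // mulr1.
  congr (_ - _); rewrite (bigD1 x) //= big1 ?eqxx; first by rewrite addr0 mul1r.
  by move=> y yx; rewrite eq_sym (negbTE yx) !mul0r.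
have apply0 u x : degree x = 0 -> apply_form u x = 0.
  by move=> dx; rewrite /apply_form big1 // => y _; rewrite degree0 ?mul0r.
(* A vertex of degree 0 has a zero row, so neither values there nor the division by zero in [kw]
   affect the form. *)
have qform_eq u1 u2 z : (forall x, degree x != 0 -> u1 x = u2 x) ->
    qform u1 z = qform u2 z.
  move=> eu; apply: eq_bigr => x _.
  by have [/apply0->|/eu->//] := eqVneq (degree x) 0; rewrite !mulr0.
(* Expand at [w - kw]: both [qform w w] (by [contr]) and [qform kw kw] (by [qform_le_degree]) are at
   most [qform kw w], which enters with coefficient -2. *)
have v'v' : qform v' v' <= 0.
  rewrite (qform_eq _ (fun x => w x - kw x)) // qform_sym.
  rewrite (qform_eq _ (fun x => w x - kw x)) //.
  have kwE : qform kw w = \sum_x apply_form w x ^+ 2 / degree x.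
    by apply: eq_bigr => x _; rewrite /kw; ring.
  have kwD : \sum_x degree x * kw x ^+ 2 = qform kw w.
    apply: eq_bigr => x _; rewrite /kw.
    have [dx|dx] := eqVneq (degree x) 0; first by (rewrite apply0 //; ring).
    by field.
  have := contr w; have := qform_le_degree kw.
  by rewrite qformBl !qformBr kwD -kwE (qform_sym w kw); lra.
have vvE : qform v v = qform v' v' + c ^+ 2 * qform one one.
  have -> : qform v' v' = qform v' v.
    by rewrite {2}/v' qformBr qformZr v'1 mulr0 subr0.
  by rewrite qformBl qformZl (qform_sym one v) /c; field.
rewrite vvE mulrDl; have -> : qform v one = c * qform one one by rewrite divfK.
rewrite -mulrA -expr2 -exprMn gerDr mulr_le0_ge0 // qform1r sumr_ge0 // => x _.
by rewrite mul1r degree_ge0.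
Qed.

End Hyperbolic.

(** * The form counting linear extensions by their first two elements *)

Section FirstLetters.

Variables (d : Order.disp_t) (X : finPOrderType d).
Implicit Types (S : {set X}) (v : X -> rat).

Definition minimal S x := (x \in S) && [forall y in S, ~~ (y < x)%O].

(* The number of linear extensions of the poset induced on S when #|S| = n. *)
Fixpoint ext n S : rat :=
  if n is n'.+1 then \sum_(x | minimal S x) ext n' (S :\ x) else 1.

(* Once x is removed, the new minimal elements inherit the value at x. *)
Definition push S x v y := if minimal S y then v y else v x.

(* For #|S| = n.+2, qform (kernel n S) counts linear extensions of S by their
   first two elements x, y; when y is not minimal in S, the pair is recorded
   as (x, x), which makes the matrix symmetric. *)
Definition kernel n S x y : rat :=
  if minimal S x then
    if x == y then \sum_(z | minimal (S :\ x) z && ~~ minimal S z) ext n (S :\ x :\ z)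
    else if minimal S y then ext n (S :\ x :\ y) else 0
  else 0.

Lemma setD1C S x y : S :\ x :\ y = S :\ y :\ x.
Proof. by apply/setP => z; rewrite !inE andbCA. Qed.

Lemma minimal_in S x : minimal S x -> x \in S.
Proof. by case/andP. Qed.

Lemma minimalD1E S x y : y \in S -> x != y ->
  minimal S x = minimal (S :\ y) x && ~~ (y < x)%O.
Proof.
move=> yS xy; rewrite /minimal !inE xy /=; case: (x \in S) => //=.
apply/forallP/andP => [h|[/forallP h yx] z].
  split; last by have := h y; rewrite yS.
  by apply/forallP => z; apply/implyP; rewrite !inE => /andP[_]; apply/implyP/h.
by have [->|zy] := eqVneq z y; [rewrite yx implybT | have := h z; rewrite !inE zy].
Qed.

Lemma minimal_exists S : S != set0 -> exists x, minimal S x.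
Proof.
case/set0Pn => x0 x0S.
case: (arg_minnP (fun x => #|[set y in S | (y < x)%O]|) x0S) => x xS xmin.
exists x; apply/andP; split=> //; apply/forallP => y; apply/implyP => yS.
apply/negP => yx; have := xmin y yS; rewrite leqNgt => /negP; apply.
apply/proper_card/properP; split.
  by apply/subsetP => z; rewrite !inE => /andP[-> /lt_trans->].
by exists y; rewrite !inE yS ?yx // ltxx.
Qed.

Lemma ext_ge0 n S : 0 <= ext n S.
Proof. by elim: n S => [|n IH] S //=; apply: sumr_ge0. Qed.

Lemma ext_gt0 n S : (n <= #|S|)%N -> 0 < ext n S.
Proof.
elim: n S => [|n IH] S //= nS.
have [|x xmin] := @minimal_exists S; first by rewrite -card_gt0; case: #|S| nS.
rewrite (bigD1 x) //=; apply: ltr_wpDr.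
  by apply: sumr_ge0 => y _; apply: ext_ge0.
by apply: IH; move: nS; rewrite (cardsD1 x S) (minimal_in xmin) add1n.
Qed.

(** The diagonal entry of [kernel] collects exactly the [y] at which [push] returns [v x]. *)
Lemma apply_kernel n S v x : apply_form (kernel n S) v x =
  if minimal S x
  then \sum_(y | minimal (S :\ x) y) push S x v y * ext n (S :\ x :\ y) else 0.
Proof.
rewrite /apply_form /kernel; case: ifP => xS; last first.
  by rewrite big1 // => y _; rewrite mul0r.
rewrite (bigD1 x) //= eqxx [RHS](bigID (minimal S)) /= addrC; congr (_ + _).
  rewrite big_mkcond [RHS]big_mkcond; apply: eq_bigr => y _ /=.
  have [yx|yx] := eqVneq y x; first by rewrite yx /minimal !inE eqxx.
  rewrite /= /push (minimalD1E (minimal_in xS) yx).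
  by case: minimal; case: (x < y)%O; rewrite ?mul0r //= mulrC.
rewrite mulr_suml; apply: eq_bigr => y /andP[_ /negbTE yS].
by rewrite /push yS mulrC.
Qed.

Lemma degree_kernel n S x :
  degree (kernel n S) x = if minimal S x then ext n.+1 (S :\ x) else 0.
Proof.
have -> : degree (kernel n S) x = apply_form (kernel n S) (fun=> 1) x.
  by apply: eq_bigr => y _; rewrite mulr1.
rewrite apply_kernel; case: ifP => // _.
by apply: eq_bigr => y _; rewrite /push if_same mul1r.
Qed.

Lemma kernel_sym n S x y : kernel n S x y = kernel n S y x.
Proof.
rewrite /kernel [y == x]eq_sym; case: (eqVneq x y) => [->//|_].
by rewrite setD1C; do 2!case: minimal.
Qed.

Lemma kernel_ge0 n S x y : 0 <= kernel n S x y.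
Proof.
rewrite /kernel; do 3?case: ifP => // _; rewrite ?ext_ge0 //.
by apply: sumr_ge0 => *; apply: ext_ge0.
Qed.

Lemma qform_kernel n S v w : qform (kernel n S) v w =
  \sum_(x | minimal S x) \sum_(y | minimal (S :\ x) y)
     v x * push S x w y * ext n (S :\ x :\ y).
Proof.
rewrite [RHS]big_mkcond; apply: eq_bigr => x _; rewrite apply_kernel.
case: ifP => _; last by rewrite mulr0.
by rewrite mulr_sumr; apply: eq_bigr => y _; rewrite mulrA.
Qed.

Lemma qform_kernel1 n S v : qform (kernel n S) v (fun=> 1) =
  \sum_(x | minimal S x) v x * ext n.+1 (S :\ x).
Proof.
rewrite qform1r [RHS]big_mkcond; apply: eq_bigr => x _.
by rewrite degree_kernel; case: ifP; rewrite ?mulr0.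
Qed.

(* The contribution of the order x, y, z to the difference of the two sides of
   qform_kernel_pullback, when x, y, z have no predecessor outside {x, y, z};
   the booleans are the values of x < y, x < z, ... *)
Definition order_term (a b c : rat) (xy xz yx yz zx zy : bool) : rat :=
  let b' := if ~~ zy && ~~ xy then b else a in
  let c' := if ~~ yz then if ~~ yz && ~~ xz then c else a else b' in
  if [&& ~~ zx && ~~ yx & ~~ zy] then b' * (c' - a) else 0.

(** Only the sum over the six orders has a sign: for an antichain a single term is [b * (c - a)].
    All 64 boolean patterns are checked, including those that come from no order. *)
Lemma order_terms_ge0 a b c xy xz yx yz zx zy :
  0 <= order_term a b c xy xz yx yz zx zy + order_term a c b xz xy zx zy yx yz
     + order_term b a c yx yz xy xz zy zx + order_term b c a yz yx zy zx xy xz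
     + order_term c a b zx zy xz xy yz yx + order_term c b a zy zx yz yx xz xy.
Proof.
have := sqr_ge0 (a - b); have := sqr_ge0 (a - c); have := sqr_ge0 (b - c).
rewrite /order_term; case: xy; case: xz; case: yx; case: yz; case: zx; case: zy => /=; nra.
Qed.

(** Both sides expand over the first three elements. Grouping the six orders of the same three
    elements leaves a common weight, the number of ways to continue, times the sum in
    [order_terms_ge0]. *)
Lemma qform_kernel_pullback n S v : qform (kernel n.+1 S) v v <=
  \sum_(x | minimal S x) qform (kernel n (S :\ x)) (push S x v) (push S x v).
Proof.
pose term x y z := if [&& minimal S x, minimal (S :\ x) y & minimal (S :\ x :\ y) z]
  then push S x v y * (push (S :\ x) y (push S x v) z - v x) else 0.
pose G x y z := term x y z * ext n (S :\ x :\ y :\ z).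
rewrite -subr_ge0; have -> : \sum_(x | minimal S x)
    qform (kernel n (S :\ x)) (push S x v) (push S x v) - qform (kernel n.+1 S) v v
    = \sum_x \sum_y \sum_z G x y z.
  rewrite qform_kernel -sumrB big_mkcond; apply: eq_bigr => x _.
  rewrite /G /term; case: ifP => _ /=; last first.
    by rewrite big1 // => y _; rewrite big1 // => z _; rewrite mul0r.
  rewrite qform_kernel -sumrB big_mkcond; apply: eq_bigr => y _.
  case: ifP => _ /=; last by rewrite big1 // => z _; rewrite mul0r.
  rewrite mulr_sumr -sumrB big_mkcond; apply: eq_bigr => z _.
  by case: ifP => _; [ring | rewrite mul0r].
have swap12 (H : X -> X -> X -> rat) :
    \sum_x \sum_y \sum_z H x y z = \sum_x \sum_y \sum_z H y x z.
  exact: exchange_big.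
have swap23 (H : X -> X -> X -> rat) :
    \sum_x \sum_y \sum_z H x y z = \sum_x \sum_y \sum_z H x z y.
  by apply: eq_bigr => x _; apply: exchange_big.
have E1 := swap23 G; have E2 := swap12 G.
have E3 := swap23 (fun x y z => G y x z).
have E4 := swap12 (fun x y z => G x z y).
have E5 := swap12 (fun x y z => G z x y).
suff : 0 <= \sum_x \sum_y \sum_z
    (G x y z + G x z y + G y x z + G y z x + G z x y + G z y x).
  have -> : \sum_x \sum_y \sum_z
    (G x y z + G x z y + G y x z + G y z x + G z x y + G z y x)
    = (\sum_x \sum_y \sum_z G x y z) *+ 6.
    under eq_bigr do under eq_bigr do rewrite !big_split /=.
    under eq_bigr do rewrite !big_split /=.
    rewrite !big_split /=.
    by rewrite -E5 -E4 -E3 -E2 -E1; ring.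
  by rewrite pmulrn_lge0.
apply: sumr_ge0 => x _; apply: sumr_ge0 => y _; apply: sumr_ge0 => z _.
(* [last] says that the three elements are distinct members of [S] with no predecessor in [S]
   besides one another. It is invariant under permutation, and all six terms vanish when it
   fails. *)
pose last x y z := [&& minimal (S :\ y :\ z) x, minimal (S :\ x :\ z) y
                    & minimal (S :\ x :\ y) z].
have last12 a b c : last b a c = last a b c.
  by rewrite /last [S :\ b :\ a]setD1C andbCA.
have last23 a b c : last a c b = last a b c.
  by rewrite /last [S :\ c :\ b]setD1C [minimal (S :\ a :\ b) c && _]andbC.
have lastE := (last23 z x y, last12 x z y, last23 y x z, last12 x y z, last23 x y z).
have termE a b c : last a b c -> term a b c =
    order_term (v a) (v b) (v c) (a < b)%O (a < c)%O (b < a)%O (b < c)%O (c < a)%O (c < b)%O.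
  case/and3P => ma mb mc; rewrite /term /push.
  have := minimal_in ma; rewrite !inE => /and3P[ac ab aS].
  have := minimal_in mb; rewrite !inE => /and3P[bc ba bS].
  have := minimal_in mc; rewrite !inE => /and3P[cb ca cS].
  rewrite (minimalD1E bS ab) (minimalD1E aS ba) (minimalD1E aS ca).
  rewrite (@minimalD1E (S :\ b) a c) ?(@minimalD1E (S :\ a) b c) ?(@minimalD1E (S :\ a) c b);
    rewrite ?inE ?ac ?bc ?cb ?ab ?ba ?ca //.
  by rewrite ma mb mc /= ?andbT.
have term0 a b c : ~~ last a b c -> term a b c = 0.
  rewrite /term; case: ifP => // /and3P[ma mb mc] /negP[].
  have := minimal_in mb; rewrite !inE => /andP[ba bS].
  have := minimal_in mc; rewrite !inE => /and3P[cb ca cS].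
  have aS := minimal_in ma.
  move: ma mb; rewrite (@minimalD1E S a b) // 1?eq_sym //.
  rewrite (@minimalD1E (S :\ b) a c) ?inE ?cb // 1?eq_sym //.
  rewrite (@minimalD1E (S :\ a) b c) ?inE ?ca // 1?eq_sym //.
  by rewrite /last mc => /andP[/andP[-> _] _] /andP[-> _].
have -> : G x y z + G x z y + G y x z + G y z x + G z x y + G z y x =
  (term x y z + term x z y + term y x z + term y z x + term z x y + term z y x)
    * ext n (S :\ x :\ y :\ z).
  rewrite /G [S :\ z :\ y]setD1C [S :\ y :\ x]setD1C [S :\ z :\ x]setD1C.
  rewrite [S :\ x :\ z :\ y]setD1C [S :\ y :\ z :\ x]setD1C [S :\ y :\ x]setD1C.
  by ring.
rewrite mulr_ge0 ?ext_ge0 //; have [lst|nlst] := boolP (last x y z).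
  by rewrite !termE ?order_terms_ge0 ?lastE.
by rewrite !term0 ?addr0 ?lastE.
Qed.

(** Base case: an incomparable pair gives [2 * v a * v b <= v a ^+ 2 + v b ^+ 2], a comparable pair
    gives equality. *)
Lemma kernel0_contraction S v : #|S| = 2%N ->
  qform (kernel 0 S) v v
    <= \sum_x apply_form (kernel 0 S) v x ^+ 2 / degree (kernel 0 S) x.
Proof.
move=> /eqP/cards2P[a [b [ab SE]]].
have S2 (H : X -> rat) : (forall x, ~~ minimal S x -> H x = 0) ->
    \sum_x H x = H a + H b.
  move=> H0; rewrite (bigD1 a) // (bigD1 b) 1?eq_sym //= big1 ?addr0 //.
  move=> x /andP[xa xb]; apply: H0; apply/negP => /minimal_in.
  by rewrite SE !inE (negbTE xa) (negbTE xb).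
have min1 (x y : X) : minimal [set x] y = (y == x).
  rewrite /minimal inE andb_idr // => /eqP ->.
  by apply/forallP => z; apply/implyP; rewrite inE => /eqP ->; rewrite ltxx.
have Sa : S :\ a = [set b].
  by rewrite SE setU1K // inE.
have Sb : S :\ b = [set a] by rewrite SE setUC setU1K // inE eq_sym.
have aS : a \in S by rewrite SE !inE eqxx.
have bS : b \in S by rewrite SE !inE eqxx orbT.
have mina : minimal S a = ~~ (b < a)%O by rewrite (minimalD1E bS) // Sb min1 eqxx.
have minb : minimal S b = ~~ (a < b)%O.
  by rewrite (minimalD1E aS) 1?eq_sym // Sa min1 eqxx.
rewrite /qform !S2; last 2 first.
- by move=> x /negbTE nx; rewrite apply_kernel nx expr0n mul0r.
- by move=> x /negbTE nx; rewrite apply_kernel nx mulr0.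
rewrite !apply_kernel !degree_kernel /= Sa Sb.
rewrite !(eq_bigl _ _ (min1 _)) !big_pred1_eq /push !mulr1.
rewrite mina minb.
have := sqr_ge0 (v a - v b).
by case: (a < b)%O; case: (b < a)%O; rewrite /= ?invr0 ?divr1; nra.
Qed.

Lemma kernel_hyperbolic n S v : #|S| = n.+2 ->
  qform (kernel n S) v v * qform (kernel n S) (fun=> 1) (fun=> 1)
    <= qform (kernel n S) v (fun=> 1) ^+ 2.
Proof.
elim: n S v => [|n IH] S v Sn; apply: hyperbolic_of_contraction.
- exact: kernel_sym.
- exact: kernel_ge0.
- move=> x y xy; rewrite !degree_kernel /kernel (negbTE xy).
  case: ifP => [xS|]; last by rewrite eqxx.
  by case: ifP => [yS _ _|]; [apply: ext_gt0 | rewrite eqxx].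
- by move=> w; apply: kernel0_contraction.
- exact: kernel_sym.
- exact: kernel_ge0.
- move=> x y xy; rewrite !degree_kernel /kernel (negbTE xy).
  case: ifP => [xS|]; last by rewrite eqxx.
  case: ifP => [yS _ _|]; last by rewrite eqxx.
  apply: ext_gt0; move: Sn; rewrite (cardsD1 x) (cardsD1 y (S :\ x)).
  by rewrite !inE (minimal_in xS) (minimal_in yS) [y == x]eq_sym xy !add1n => -[->].
move=> w; apply: (le_trans (qform_kernel_pullback n S w)).
rewrite big_mkcond; apply: ler_sum => x _; rewrite apply_kernel degree_kernel.
case: ifP => xS; last by rewrite expr0n mul0r.
have Sxn : #|S :\ x| = n.+2.
  by move: Sn; rewrite (cardsD1 x) (minimal_in xS) add1n => -[].
(* The degree of [x] in the large form equals the total mass of the form on [S :\ x], so this is the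
   induction hypothesis divided by that mass. *)
rewrite ler_pdivlMr; last by rewrite ext_gt0 ?Sxn.
have := IH (S :\ x) (push S x w) Sxn; rewrite !qform_kernel1 /=.
by under [X in _ * X]eq_bigr do rewrite mul1r.
Qed.

End FirstLetters.

(** * Linear extensions with a prescribed initial segment *)

Section Counting.

Variables (d : Order.disp_t) (X : finPOrderType d).
Implicit Types (p : seq X) (f : {ffun X -> 'I_#|X|}).

Definition starts_with p f := all (fun x => f x == index x p :> nat) p.

(** A nonmember has index [size p], so the inequality also forces [p] to contain all predecessors of
    its elements. *)
Definition natural p :=
  uniq p /\ forall x y, y \in p -> (x < y)%O -> (index x p < index y p)%N.

Definition count_prefix p (E : pred {ffun X -> 'I_#|X|}) : nat :=
  #|[set f in lin_ext X | starts_with p f && E f]|.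

Lemma lin_extP f : reflect
  [/\ injective f, forall i, exists x, f x = i
    & forall u v, (u < v)%O -> (f u < f v)%N]
  (f \in lin_ext X).
Proof.
rewrite inE; apply: (iffP andP) => [[/andP[/injectiveP fi /forallP fs] /forallP fm]|].
  split=> // [i|u v uv]; first by have /existsP[x /eqP] := fs i; exists x.
  by have /forallP/(_ v)/implyP := fm u; apply.
move=> [fi fs fm]; split; first (apply/andP; split).
- exact/injectiveP.
- by apply/forallP => i; apply/existsP; have [x <-] := fs i; exists x.
by apply/forallP => u; apply/forallP => v; apply/implyP/fm.
Qed.

Lemma starts_with_rcons p x f : x \notin p ->
  starts_with (rcons p x) f = starts_with p f && (f x == size p :> nat).
Proof.
move=> xp; rewrite /starts_with all_rcons andbC -cats1; congr (_ && _).
  by apply: eq_in_all => y yp; rewrite index_cat yp.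
by rewrite index_cat (negbTE xp) /= eqxx addn0.
Qed.

Lemma natural_rcons p x :
  natural p -> minimal (~: [set y in p]) x -> natural (rcons p x).
Proof.
move=> [pu pn] /andP[]; rewrite !inE => xp /forallP xmin; split.
  by rewrite rcons_uniq xp.
have xnp u : (u < x)%O -> u \in p.
  move=> ux; apply: contraLR ux => up.
  by have := xmin u; rewrite !inE up.
move=> u w; rewrite mem_rcons inE -cats1 !index_cat => /predU1P[->|wp] uw.
  by rewrite (negbTE xp) xnp //= eqxx addn0 index_mem xnp.
rewrite wp; have iu := pn u w wp uw.
by rewrite ifT // -index_mem (ltn_trans iu) // index_mem.
Qed.

(** Split by the element at the first free position. It is minimal among the remaining ones, since
    anything smaller sits at an earlier position and these are all occupied by [p]. *)
Lemma count_prefix_split p (E : pred {ffun X -> 'I_#|X|}) :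
  natural p -> (size p < #|X|)%N ->
  count_prefix p E =
    (\sum_(x | minimal (~: [set y in p]) x) count_prefix (rcons p x) E)%N.
Proof.
move=> [pu pn] pX; pose i := Ordinal pX.
have -> : count_prefix p E =
    (\sum_x #|[set f in lin_ext X | [&& starts_with p f, E f & f x == i]]|)%N.
  rewrite /count_prefix -sum1_card.
  under [RHS]eq_bigr do rewrite -sum1_card big_mkcond.
  rewrite exchange_big big_mkcond; apply: eq_bigr => f _ /=.
  rewrite inE; case: ifP => [/and3P[fl fp fE]|fn]; last first.
    rewrite big1 // => x _; rewrite inE; case: ifP => // /and4P[h1 h2 h3 _].
    by rewrite h1 h2 h3 in fn.
  have /lin_extP[fi fs _] := fl; have [x fx] := fs i.
  rewrite (bigD1 x) //= inE fl fp fE fx eqxx big1 // => y yx.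
  by rewrite inE -fx (inj_eq fi) (negbTE yx) !andbF.
rewrite [RHS]big_mkcond; apply: eq_bigr => x _; case: ifPn => xmin.
  apply: eq_card => f; rewrite !inE starts_with_rcons; last first.
    by have := minimal_in xmin; rewrite !inE.
  by rewrite -val_eqE /= [E f && _]andbC !andbA.
apply: eq_card0 => f; rewrite inE; apply/negP => /and4P[/lin_extP[fi fs fm] /allP fp _ /eqP fx].
have inp y : (f y < size p)%N -> y \in p.
  move=> fy; have np : nth y p (f y) \in p by rewrite mem_nth.
  have /eqP := fp _ np; rewrite index_uniq // => /val_inj/fi <-; exact: np.
case/negP: xmin; apply/andP; split.
  rewrite !inE; apply/negP => xp; have /eqP := fp x xp.
  by rewrite fx /= => px; move: xp; rewrite -index_mem -px ltnn.
apply/forallP => y; apply/implyP; rewrite !inE; apply: contraNN => yx.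
by apply: inp; have := fm y x yx; rewrite fx.
Qed.

Lemma count_prefix_ext p : natural p ->
  (count_prefix p predT)%:R = ext (#|X| - size p) (~: [set x in p]).
Proof.
have [k] := ubnP (#|X| - size p); elim: k p => // k IH p; rewrite ltnS => pk np.
have [pu pn] := np; have [pX|Xp] := ltnP (size p) #|X|; last first.
  (* When [p] exhausts [X], the only linear extension left is [index] itself. *)
  have [pE pall'] : (size p = size (enum X)) * (p =i enum X).
    by apply: uniq_min_size => // [x _|]; rewrite ?mem_enum // -cardE.
  have pall x : x \in p by rewrite pall' mem_enum.
  have pX : size p = #|X| by rewrite pE -cardE.
  have idx x : (index x p < #|X|)%N by rewrite -pX index_mem.
  pose f0 : {ffun X -> 'I_#|X|} := [ffun x => Ordinal (idx x)].
  rewrite (_ : #|X| - size p = 0)%N; last by rewrite pX subnn.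
  rewrite /count_prefix (_ : [set f in _ | _] = [set f0]) ?cards1 //.
  apply/setP => f; rewrite inE in_set1 andbT; apply/andP/eqP => [[_ /allP fp]|->].
    by apply/ffunP => x; apply/val_inj; rewrite ffunE /=; apply/eqP/fp.
  split; last by apply/allP => x _; rewrite ffunE.
  apply/lin_extP; split=> [x y|[i iX]|u w uw].
  - by rewrite !ffunE => /(congr1 val) /= /index_inj -> .
  - have x0 : X by case: (p) pX iX => [<-//|].
    by exists (nth x0 p i); rewrite ffunE; apply/val_inj; rewrite /= index_uniq ?pX.
  - by rewrite !ffunE /= pn.
rewrite count_prefix_split // -(subnSK pX) /= natr_sum; apply: eq_bigr => x xmin.
rewrite IH ?size_rcons; [|by rewrite -subnSK // in pk | exact: natural_rcons].
congr ext; apply/setP => y; rewrite !inE mem_rcons inE negb_or //.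
Qed.

End Counting.

(** * From positions of [A] to the quadratic form *)

Section FirstPosition.

Variables (d : Order.disp_t) (X : finPOrderType d).
Implicit Types (A : {set X}) (f : {ffun X -> 'I_#|X|}).

Lemma fmin_le A f a : a \in A -> (fmin A f <= pos f a)%N.
Proof.
rewrite /fmin; have := mem_index_enum a.
elim: (index_enum X) => // b r IH; rewrite inE big_cons => /predU1P[->|ar] aA.
  by rewrite aA geq_minl.
by case: ifP => _; rewrite ?geq_min IH ?orbT.
Qed.

(** The bound on [k] accounts for the default value [#|X|] of [fmin]. *)
Lemma fmin_gt A f k : (k < #|X|)%N ->
  (forall a, a \in A -> (k < pos f a)%N) -> (k < fmin A f)%N.
Proof. by move=> kX kA; apply: (big_ind (fun y => k < y)%N) => // x y kx ky; rewrite leq_min kx. Qed.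

Lemma count_first A x : (1 < #|X|)%N ->
  count_prefix [:: x] (fun f => 1 < fmin A f)%N =
  if x \in A then 0%N else count_prefix [:: x] predT.
Proof.
move=> X1; case: ifPn => xA.
  apply: eq_card0 => f; rewrite inE /starts_with /= eqxx andbT.
  apply/negP => /and3P[_ /eqP fx]; apply/negP; rewrite -leqNgt.
  by rewrite (leq_trans (fmin_le f xA)) // /pos fx.
apply: eq_card => f; rewrite inE [RHS]inE.
apply/idP/idP => [/and3P[-> -> _] //|/and3P[fl fp _]]; rewrite fl fp /=.
move: fp; rewrite /starts_with /= eqxx andbT => /eqP fx.
apply: fmin_gt => // a aA; rewrite /pos ltnS lt0n -fx; apply/eqP.
have /lin_extP[fi _ _] := fl.
by move=> /val_inj/fi ax; rewrite -ax aA in xA.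
Qed.

(** Equality can fail for empty [A] and [#|X| = 2], where the default value keeps [fmin] at 2. *)
Lemma count_first_two A x y :
  (count_prefix [:: x; y] (fun f => 2 < fmin A f)%N <=
  if (x \in A) || (y \in A) then 0 else count_prefix [:: x; y] predT)%N.
Proof.
case: ifPn => [xyA|_]; last first.
  apply/subset_leq_card/subsetP => f; rewrite inE => /and3P[fl fp _].
  by rewrite inE fl fp.
rewrite leqn0; apply/eqP/eq_card0 => f; rewrite inE.
apply/negP => /and3P[_ /allP fp]; apply/negP; rewrite -leqNgt.
have [a aA axy] : exists2 a, a \in A & a \in [:: x; y].
  by case/orP: xyA => ?; [exists x | exists y]; rewrite // !inE eqxx ?orbT.
rewrite (leq_trans (fmin_le f aA)) // /pos (eqP (fp a axy)).
by rewrite -(index_mem a) in axy.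
Qed.

Lemma PrD (E E1 E2 : pred {ffun X -> 'I_#|X|}) :
  (forall f, E f = E1 f || E2 f) -> (forall f, ~~ (E1 f && E2 f)) ->
  Pr E = Pr E1 + Pr E2.
Proof.
move=> EU EI; rewrite /Pr -mulrDl -natrD -cardsUI.
have -> : [set f in lin_ext X | E1 f] :&: [set f in lin_ext X | E2 f] = set0.
  by apply/setP => f; rewrite !inE andbACA (negbTE (EI f)) andbF.
rewrite cards0 addn0; congr (_%:R / _); apply: eq_card => f.
by rewrite !inE EU andb_orr.
Qed.

Lemma card_lin_ext : #|lin_ext X|%:R = ext #|X| (setT : {set X}).
Proof.
have -> : #|lin_ext X| = count_prefix ([::] : seq X) predT.
  by apply: eq_card => f; rewrite inE andbT.
by rewrite count_prefix_ext // subn0; congr ext; apply/setP => z; rewrite !inE.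
Qed.

Lemma lin_ext_gt0 : (0 < #|lin_ext X|)%N.
Proof. by rewrite -(ltr_nat rat) card_lin_ext ext_gt0 // cardsT. Qed.

Lemma count_fmin_log_concave A : (1 < #|X|)%N ->
  (#|lin_ext X| * #|[set f in lin_ext X | 2 < fmin A f]|
     <= #|[set f in lin_ext X | 1 < fmin A f]| ^ 2)%N.
Proof.
move=> X1; have [m Xm] : exists m, #|X| = m.+2 by case: #|X| X1 => [|[|m]] //; exists m.
have nat0 : natural ([::] : seq X) by [].
have set0E : ~: [set z in [::] : seq X] = setT by apply/setP => z; rewrite !inE.
have set1E (x : X) : ~: [set z in [:: x]] = setT :\ x.
  by apply/setP => z; rewrite !inE andbT.
have set2E (x y : X) : ~: [set z in [:: x; y]] = setT :\ x :\ y.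
  by apply/setP => z; rewrite !inE negb_or andbT andbC.
have nat1 (x : X) : minimal setT x -> natural [:: x].
  by move=> xm; apply: (@natural_rcons _ _ [::] x nat0); rewrite set0E.
have nat2 (x y : X) : minimal setT x -> minimal (setT :\ x) y -> natural [:: x; y].
  by move=> xm ym; apply: (@natural_rcons _ _ [:: x] y (nat1 _ xm)); rewrite set1E.
have countE E : #|[set f in lin_ext X | E f]| = count_prefix ([::] : seq X) E by [].
pose v x : rat := (x \notin A)%:R.
have N0q : #|lin_ext X|%:R = qform (kernel m (setT : {set X})) (fun=> 1) (fun=> 1).
  by rewrite card_lin_ext Xm qform_kernel1; apply: eq_bigr => x _; rewrite mul1r.
have N1q : #|[set f in lin_ext X | 1 < fmin A f]%N|%:R
    = qform (kernel m (setT : {set X})) v (fun=> 1).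
  rewrite countE count_prefix_split // ?Xm // set0E natr_sum qform_kernel1.
  apply: eq_bigr => x xm /=; rewrite count_first // /v; case: ifP => _.
    by rewrite mul0r.
  by rewrite mul1r count_prefix_ext ?set1E ?Xm ?subn1 //; apply: nat1.
have N2q : #|[set f in lin_ext X | 2 < fmin A f]%N|%:R
    <= qform (kernel m (setT : {set X})) v v.
  rewrite countE count_prefix_split // ?Xm // set0E natr_sum qform_kernel.
  apply: ler_sum => x xm /=; rewrite count_prefix_split ?Xm //; last exact: nat1.
  rewrite set1E natr_sum; apply: ler_sum => y ym /=.
  apply: (@le_trans _ _ (v x * v y * ext m (setT :\ x :\ y))).
    apply: (@le_trans _ _ (if (x \in A) || (y \in A) then 0%N
                           else count_prefix [:: x; y] predT)%:R).
      by rewrite ler_nat count_first_two.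
    rewrite /v; case: (x \in A); case: (y \in A); rewrite /= ?mul0r ?mulr0 ?mul0r //.
    by rewrite !mul1r count_prefix_ext ?set2E ?Xm ?subn2 //; apply: nat2.
  (* For [y] not minimal, [push] puts [v x] in place of [v y]; the bound holds because [v] takes the
     values 0 and 1. *)
  rewrite ler_wpM2r ?ext_ge0 // /push; case: ifP => // _.
  by rewrite /v; case: (x \in A); case: (y \in A).
rewrite -(ler_nat rat) natrM natrX N1q N0q mulrC.
have Tm : #|[set: X]| = m.+2 by rewrite cardsT.
apply: le_trans (kernel_hyperbolic v Tm); rewrite ler_wpM2r // -N0q; exact: ler0n.
Qed.

End FirstPosition.

Theorem theorem1p6 (d : Order.disp_t) (X : finPOrderType d)
    (hX : (2 <= #|X|)%N) (A : {set X}) (hA : A != set0) :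
  (Pr (fun f => (2 < fmin A f)%N) <= Pr (fun f => (1 < fmin A f)%N) ^+ 2)%R
  /\ (Pr (fun f => fmin A f == 1%N) * Pr (fun f => (1 < fmin A f)%N)
      <= Pr (fun f => fmin A f == 2%N))%R.
Proof.
have cnt := count_fmin_log_concave A hX; have L0 := lin_ext_gt0 X.
have p1 : Pr (fun f => 0 < fmin A f)%N = 1.
  rewrite /Pr (_ : [set f in _ | _] = lin_ext X) ?divff ?pnatr_eq0 -?lt0n //.
  by apply/setP => f; rewrite inE fmin_gt ?andbT // (leq_trans _ hX).
have D1 : Pr (fun f => 0 < fmin A f)%N =
    Pr (fun f => fmin A f == 1%N) + Pr (fun f => 1 < fmin A f)%N.
  by apply: PrD => f; case: (fmin A f) => [|[|k]].
have D2 : Pr (fun f => 1 < fmin A f)%N =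
    Pr (fun f => fmin A f == 2%N) + Pr (fun f => 2 < fmin A f)%N.
  by apply: PrD => f; case: (fmin A f) => [|[|[|k]]].
have le2 : Pr (fun f => 2 < fmin A f)%N <= Pr (fun f => 1 < fmin A f)%N ^+ 2.
  rewrite /Pr expr_div_n ler_pdivlMr ?exprn_gt0 ?ltr0n //.
  rewrite expr2 mulrA divfK ?pnatr_eq0 -?lt0n // mulrC.
  by rewrite -natrM -natrX ler_nat.
(* With p and q the probabilities of [1 < fmin A f] and [2 < fmin A f], the second claim reads (1 -
   p) p <= p - q, that is q <= p^2. *)
by split=> //; nra.
Qed.
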